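(* Let $f_1,\dots,f_m:\mathbb{R}^n\to\mathbb{R}$ be convex and continuously differentiable with each $\nabla f_i$ locally Lipschitz continuous. Let $g:\mathbb{R}^m\to\mathbb{R}\cup\{+\infty\}$ be convex, proper, lower semicontinuous, $L_g$-Lipschitz continuous on its domain (i.e. $|g(u)-g(v)|\le L_g\|u-v\|$ for all $u,v\in\mathrm{dom}\,g$), and nondecreasing in its $i$-th argument for every $i$ such that $f_i$ is not affine. Put $F=(f_1,\dots,f_m)$, $$\Gamma=\{\bm{\alpha}\in\mathbb{R}^m_+:\ \alpha_i=0\text{ if }f_i\text{ is affine},\ \alpha_i>0\text{ if }f_i\text{ is not affine},\ i=1,\dots,m\},$$ and, for $\bm{\alpha}\in\Gamma$, $H_{\bm{\alpha}}(x,y)=F(x)+\nabla F(x)(y-x)+\frac{\bm{\alpha}}{2}\|y-x\|^2$. Let $\bm{\alpha}_0\in\Gamma$ and $\eta>1$. Assume that $g\circ F$ is proper and has a minimizer, that $F^{-1}(\mathrm{int}\,\mathrm{dom}\,g)\ne\emptyset$, that $g\circ F$ is coercive, and that for every $x\in F^{-1}(\mathrm{dom}\,g)$ the function $y\mapsto g(H_{\bm{\alpha}_0}(x,y))$ is coercive. Then any sequence $(x_k)_{k\in\mathbb{N}}$ generated by the multiproximal method with backtracking step sizes (described in the context), started from some $x_0\in F^{-1}(\mathrm{dom}\,g)$ with data $\bm{\alpha}_0,\eta$, converges to a single point in the solution set $S=\mathrm{argmin}\,g\circ F$.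
   Context: $\|\cdot\|$ is the Euclidean norm; $\mathrm{dom}\,g=\{z:g(z)<+\infty\}$; $\nabla F(x)$ is the $m\times n$ Jacobian of $F$; inequalities between vectors are coordinatewise. A function $\varphi:\mathbb{R}^n\to\mathbb{R}\cup\{+\infty\}$ is coercive if $\varphi(y)\to+\infty$ as $\|y\|\to+\infty$. For $x\in F^{-1}(\mathrm{dom}\,g)$ and $\bm{\alpha}\in\Gamma$, $p_{\bm{\alpha}}(x)=\mathrm{argmin}_{y\in\mathbb{R}^n} g(H_{\bm{\alpha}}(x,y))$. Multiproximal method with backtracking step sizes. Given $x_0\in F^{-1}(\mathrm{dom}\,g)$, $\bm{\alpha}_0\in\Gamma$, $\eta>1$, iterate for $k\in\mathbb{N}$: Step 1. Set $\tilde{\bm{\alpha}}=\bm{\alpha}_k$ and choose $\tilde x\in p_{\tilde{\bm{\alpha}}}(x_k)$. Step 2. While $H_{\tilde{\bm{\alpha}}}(x_k,\tilde x)\ge F(\tilde x)$ is not satisfied: for each $i=1,\dots,m$ such that $f_i(\tilde x)>f_i(x_k)+\nabla f_i(x_k)^T(\tilde x-x_k)+\frac{\tilde\alpha_i}{2}\|\tilde x-x_k\|^2$, replace $\tilde\alpha_i$ by $\eta\tilde\alpha_i$; then choose a new $\tilde x\in p_{\tilde{\bm{\alpha}}}(x_k)$. When the loop ends, set $\bm{\alpha}_{k+1}=\tilde{\bm{\alpha}}$. Step 3. If $x_k\in p_{\bm{\alpha}_{k+1}}(x_k)$, set $x_{k+1}=x_k$; otherwise set $x_{k+1}=\tilde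 x$. *)

(* Defs.v *)
From HB Require Import structures.
From mathcomp Require Export all_boot all_order all_algebra.
From mathcomp Require Export all_classical all_reals all_analysis.
Set Implicit Arguments.
Unset Strict Implicit.
Unset Printing Implicit Defensive.
Export Order.TTheory GRing.Theory Num.Theory.
Export numFieldNormedType.Exports.
Local Open Scope classical_set_scope.
Local Open Scope ring_scope.

Section Euclidean.
Context {R : realType}.

(* The library norm on 'rV[R]_n is the sup norm; it induces the same topology
   as enorm, but the constants and the model H below need the Euclidean one. *)
Definition enorm {n : nat} (x : 'rV[R]_n) : R :=
  Num.sqrt (\sum_(i < n) x 0 i ^+ 2).

Definition grad {n : nat} (h : 'rV[R]_n -> R^o) (x : 'rV[R]_n) : 'rV[R]_n :=
  \row_(j < n) 'D_(delta_mx 0 j) h x.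

Definition continuously_differentiable {n : nat} (h : 'rV[R]_n -> R^o) : Prop :=
  (forall x, differentiable h x) /\ continuous (grad h).

Definition locally_lipschitz {n p : nat} (h : 'rV[R]_n -> 'rV[R]_p) : Prop :=
  forall x : 'rV[R]_n, exists L : R, exists2 U : set 'rV[R]_n, nbhs x U &
    forall y z, U y -> U z -> enorm (h y - h z) <= L * enorm (y - z).

Definition affine {n : nat} (h : 'rV[R]_n -> R^o) : Prop :=
  exists (l : {linear 'rV[R]_n -> R^o}) (b : R), forall x, h x = l x + b.

Definition vle {m : nat} (u v : 'rV[R]_m) : Prop := forall i, u 0 i <= v 0 i.

End Euclidean.

(* Functions R^n -> R u {+oo} are maps into \bar R; the value -oo is excluded
   by properness. *)
Section ExtendedReal.
Context {R : realType}.
Local Open Scope ereal_scope.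

Definition edom {n : nat} (phi : 'rV[R]_n -> \bar R) : set 'rV[R]_n :=
  [set u | phi u < +oo].

Definition eproper {n : nat} (phi : 'rV[R]_n -> \bar R) : Prop :=
  (forall u, phi u != -oo) /\ edom phi !=set0.

(* Recall that 0 * +oo = 0 in \bar R, so that t = 0 and t = 1 are harmless. *)
Definition econvex {n : nat} (phi : 'rV[R]_n -> \bar R) : Prop :=
  forall (t : R) (u v : 'rV[R]_n), (0 <= t <= 1)%R ->
    phi (t *: u + (1 - t) *: v)%R <= t%:E * phi u + (1 - t)%:E * phi v.

Definition lipschitz_on_dom {n : nat} (L : R) (phi : 'rV[R]_n -> \bar R) : Prop :=
  forall u v, edom phi u -> edom phi v ->
    `|phi u - phi v| <= (L * enorm (u - v))%:E.

Definition nondecreasing_in {n : nat} (i : 'I_n) (phi : 'rV[R]_n -> \bar R) : Prop :=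
  forall u v : 'rV[R]_n, (forall j, j != i -> u 0%R j = v 0%R j) ->
    (u 0 i <= v 0 i)%R -> phi u <= phi v.

Definition coercive {n : nat} (phi : 'rV[R]_n -> \bar R) : Prop :=
  forall A : R, exists r : R, forall y, (r <= enorm y)%R -> A%:E <= phi y.

Definition argmin {n : nat} (phi : 'rV[R]_n -> \bar R) : set 'rV[R]_n :=
  [set x | forall y, phi x <= phi y].

End ExtendedReal.

Section Multiproximal.
Context {R : realType} {n m : nat}.
Variables (g : 'rV[R]_m -> \bar R) (f : 'I_m -> 'rV[R]_n -> R^o).

Definition vecfun (x : 'rV[R]_n) : 'rV[R]_m := \row_(i < m) f i x.

Definition Gamma : set 'rV[R]_m :=
  [set a | forall i, [/\ 0 <= a 0 i,
                         affine (f i) -> a 0 i = 0 &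
                         ~ affine (f i) -> 0 < a 0 i]].

(* Vectors being rows, 'J is the transpose of the m x n Jacobian matrix and
   acts on the right. *)
Definition model (a : 'rV[R]_m) (x y : 'rV[R]_n) : 'rV[R]_m :=
  vecfun x + (y - x) *m 'J vecfun x + (enorm (y - x) ^+ 2 / 2) *: a.

Definition multiprox (a : 'rV[R]_m) (x : 'rV[R]_n) : set 'rV[R]_n :=
  argmin (fun y => g (model a x y)).

Definition step_sizes_ok (a : 'rV[R]_m) (x xt : 'rV[R]_n) : Prop :=
  vle (vecfun xt) (model a x xt).

Definition enlarge (eta : R) (a : 'rV[R]_m) (x xt : 'rV[R]_n) : 'rV[R]_m :=
  \row_(i < m) if model a x xt 0 i < f i xt then eta * a 0 i else a 0 i.

(* [backtrack eta a0 x a xt]: (a, xt) is a value of the pair of local variables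
   (alpha tilde, x tilde) that can occur, at the point x and with initial step
   sizes a0, when the test of the while loop is evaluated. *)
Inductive backtrack (eta : R) (a0 : 'rV[R]_m) (x : 'rV[R]_n) :
    'rV[R]_m -> 'rV[R]_n -> Prop :=
| backtrack_init xt : multiprox a0 x xt -> backtrack eta a0 x a0 xt
| backtrack_next a xt xt' :
    backtrack eta a0 x a xt -> ~ step_sizes_ok a x xt ->
    multiprox (enlarge eta a x xt) x xt' ->
    backtrack eta a0 x (enlarge eta a x xt) xt'.

(* One iteration, from (x_k, alpha_k) = (x, a) to
   (x_{k+1}, alpha_{k+1}) = (x', a'). *)
Definition multiprox_step (eta : R) (x : 'rV[R]_n) (a : 'rV[R]_m)
    (x' : 'rV[R]_n) (a' : 'rV[R]_m) : Prop :=
  exists xt, [/\ backtrack eta a x a' xt, step_sizes_ok a' x xt,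
                 multiprox a' x x -> x' = x &
                 ~ multiprox a' x x -> x' = xt].

Definition multiprox_sequence (eta : R) (a0 : 'rV[R]_m) (x : nat -> 'rV[R]_n) :
    Prop :=
  exists a : nat -> 'rV[R]_m, a 0%N = a0 /\
    forall k, multiprox_step eta (x k) (a k) (x k.+1) (a k.+1).

End Multiproximal.

(* Main.v *)
Require Import Defs.
From mathcomp Require Import ring lra.
Local Open Scope classical_set_scope.
Local Open Scope ring_scope.
Set Implicit Arguments.
Unset Strict Implicit.
Unset Printing Implicit Defensive.

(* Write [G k] for the value of the model at [x k.+1]. Duality for the proximal
   subproblem at [x k] yields a scalar [lam k >= 0] with
   [G k <= g (F z) + lam k / 2 * (|z - x k|^2 - |z - x k.+1|^2)] for all [z].
   A point [xb] with [F xb] in the interior of [dom g], contracted towards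
   [x k], is a Slater point whose quality does not depend on [k], so [lam k] is
   bounded. Hence, as long as [x k] is not a minimizer, [x] is Fejer monotone
   with respect to the set of minimizers and the values tend to the minimum;
   every cluster point is then a minimizer, and Fejer monotonicity upgrades
   clustering to convergence. If some [x k] is a minimizer, Step 3 keeps the
   sequence there.
   The step sizes stay bounded because the trial points do (the coercivity of
   the models is uniform on the initial sublevel set) and the gradients are
   Lipschitz on bounded sets. *)

(** * Euclidean norm and inner product on row vectors *)

Section Euclidean.
Context {R : realType}.

Definition dot {n : nat} (u v : 'rV[R]_n) : R := \sum_(j < n) u 0 j * v 0 j.

Lemma enorm_ge0 n (u : 'rV[R]_n) : 0 <= enorm u.
Proof. exact: sqrtr_ge0. Qed.

Lemma enorm_sqr n (u : 'rV[R]_n) : enorm u ^+ 2 = dot u u.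
Proof.
rewrite sqr_sqrtr; first by apply: eq_bigr => i _; rewrite expr2.
by apply: sumr_ge0 => i _; exact: sqr_ge0.
Qed.

Lemma enormZ n (t : R) (u : 'rV[R]_n) : 0 <= t -> enorm (t *: u) = t * enorm u.
Proof.
move=> t0; rewrite /enorm (eq_bigr (fun i => t ^+ 2 * u 0 i ^+ 2)).
  by rewrite -mulr_sumr sqrtrM ?sqr_ge0// sqrtr_sqr ger0_norm.
by move=> i _; rewrite mxE exprMn.
Qed.

Lemma enorm0 n : enorm (0 : 'rV[R]_n) = 0.
Proof. by rewrite -(scale0r 0) enormZ// mul0r. Qed.

Lemma enormN n (u : 'rV[R]_n) : enorm (- u) = enorm u.
Proof.
by congr Num.sqrt; apply: eq_bigr => i _; rewrite mxE sqrrN.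
Qed.

Lemma normr_le_enorm n (u : 'rV[R]_n) : `|u| <= enorm u.
Proof.
rewrite [leLHS]/Num.Def.normr/= mx_normrE bigmax_le ?enorm_ge0//= => -[i j] _ /=.
rewrite (ord1 i) -sqrtr_sqr ler_wsqrtr// (bigD1 j)//= lerDl.
by apply: sumr_ge0 => k _; exact: sqr_ge0.
Qed.

Lemma enorm_eq0 n (u : 'rV[R]_n) : enorm u = 0 -> u = 0.
Proof.
move=> u0; apply/eqP; rewrite -normr_eq0 eq_le normr_ge0 andbT -u0.
exact: normr_le_enorm.
Qed.

Lemma dotZl n (t : R) (u v : 'rV[R]_n) : dot (t *: u) v = t * dot u v.
Proof. by rewrite /dot mulr_sumr; apply: eq_bigr => i _; rewrite mxE mulrA. Qed.

Lemma dotDl n (u v w : 'rV[R]_n) : dot (u + v) w = dot u w + dot v w.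
Proof. by rewrite -big_split; apply: eq_bigr => i _; rewrite mxE mulrDl. Qed.

Lemma dotBr n (u v w : 'rV[R]_n) : dot u (v - w) = dot u v - dot u w.
Proof. by rewrite -sumrB; apply: eq_bigr => i _; rewrite !mxE mulrBr. Qed.

(** Expanding [enorm (u - L *: v) ^+ 2 >= 0] gives this form of Cauchy-Schwarz directly. *)
Lemma dot_le n (L : R) (u v : 'rV[R]_n) : 0 < L ->
  enorm u <= L * enorm v -> dot v u <= L * enorm v ^+ 2.
Proof.
move=> L0 uv; have : enorm u ^+ 2 <= L ^+ 2 * enorm v ^+ 2.
  by rewrite -exprMn ler_sqr ?nnegrE ?enorm_ge0// mulr_ge0 ?enorm_ge0 ?ltW.
have : 0 <= enorm (u - L *: v) ^+ 2 by exact: sqr_ge0.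
have -> : enorm (u - L *: v) ^+ 2 =
    enorm u ^+ 2 - 2 * L * dot v u + L ^+ 2 * enorm v ^+ 2.
  rewrite !enorm_sqr /dot !mulr_sumr -sumrB -big_split/=.
  by apply: eq_bigr => i _; rewrite !mxE; ring.
move=> h1 h2; have : L * dot v u <= L * (L * enorm v ^+ 2) by nra.
by rewrite ler_pM2l.
Qed.

(** The negative term expresses strong convexity; it is the source of the distance to the new
    iterate in the three-point inequality. *)
Lemma enorm_sqr_conv n (t : R) (u v w : 'rV[R]_n) :
  enorm (t *: u + (1 - t) *: v - w) ^+ 2 =
  t * enorm (u - w) ^+ 2 + (1 - t) * enorm (v - w) ^+ 2
    - t * (1 - t) * enorm (u - v) ^+ 2.
Proof.
rewrite !enorm_sqr /dot !mulr_sumr -big_split/= -sumrB.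
by apply: eq_bigr => i _; rewrite !mxE; ring.
Qed.

(** The two sides differ by the sum of the squared coordinates of [u - 2 *: v]. This squared
    substitute for the triangle inequality serves the radius estimates below. *)
Lemma enormB_sqr_le n (u v : 'rV[R]_n) :
  enorm u ^+ 2 <= 2 * enorm (u - v) ^+ 2 + 2 * enorm v ^+ 2.
Proof.
rewrite -subr_ge0 !enorm_sqr /dot !mulr_sumr -big_split/= -sumrB.
apply: sumr_ge0 => i _; rewrite !mxE.
have := sqr_ge0 (u 0 i - 2 * v 0 i); lra.
Qed.

Lemma enormD_sqr_le n (u v : 'rV[R]_n) :
  enorm (u + v) ^+ 2 <= 2 * enorm u ^+ 2 + 2 * enorm v ^+ 2.
Proof. by have := enormB_sqr_le (u + v) v; rewrite addrK. Qed.

Lemma cvg_row m (T : Type) (F : set_system T) (h : T -> 'rV[R]_m)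
    (l : 'rV[R]_m) : Filter F ->
  (forall i, h t 0 i @[t --> F] --> l 0 i) -> h t @[t --> F] --> l.
Proof.
move=> FF hl A [B lB BA].
have : \forall t \near F, forall i, B 0 i (h t 0 i).
  by apply: filter_forall => i; exact/hl/lB.
by apply: filterS => t ht; apply: BA => i j; rewrite (ord1 i); exact: ht.
Qed.

Lemma dot_cvg n (T : Type) (F : set_system T) (u v : T -> 'rV[R]_n)
    (lu lv : 'rV[R]_n) : Filter F ->
  u t @[t --> F] --> lu -> v t @[t --> F] --> lv ->
  dot (u t) (v t) @[t --> F] --> dot lu lv.
Proof.
move=> FF ul vl; apply: (@cvg_big R _ +%R 0 xpredT (@add_continuous R^o)) => /= j _.
apply: (@cvgM R T F FF (fun t => u t 0 j) (fun t => v t 0 j));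
  apply: (cvg_comp _ (fun w : 'rV[R]_n => w 0 j)); [exact: ul| |exact: vl|];
  exact: coord_continuous.
Qed.

Lemma enorm_cvg n (T : Type) (F : set_system T) (u : T -> 'rV[R]_n)
    (lu : 'rV[R]_n) : Filter F ->
  u t @[t --> F] --> lu -> enorm (u t) ^+ 2 @[t --> F] --> enorm lu ^+ 2.
Proof.
move=> FF ul; under eq_fun do rewrite enorm_sqr.
by rewrite enorm_sqr; exact: dot_cvg.
Qed.

Lemma enorm_continuous n : continuous (@enorm R n).
Proof.
move=> u; have -> : @enorm R n = fun v => Num.sqrt (enorm v ^+ 2).
  by apply/funext => v; rewrite sqrtr_sqr ger0_norm ?enorm_ge0.
apply: (cvg_comp (fun v => enorm v ^+ 2) Num.sqrt).
  by apply: (@enorm_cvg _ _ (nbhs u) id); exact: cvg_id.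
exact: sqrt_continuous.
Qed.

Lemma enorm_bounded_compact n (A : set 'rV[R]_n) (r : R) :
  (forall u, A u -> enorm u <= r) -> closed A -> compact A.
Proof.
move=> Ar clA; apply: bounded_closed_compact => //.
exists r; split; first exact: num_real.
move=> M rM u /Ar ur /=; apply: le_trans (normr_le_enorm _) _.
exact: le_trans ur (ltW rM).
Qed.

Lemma enorm_ball_compact n (r : R) : compact [set u : 'rV[R]_n | enorm u <= r].
Proof.
apply: (@enorm_bounded_compact _ _ r) => //.
apply: (@preimage_closed _ _ (@enorm R n) [set s | s <= r]); last exact: closed_le.
by move=> u _; exact: enorm_continuous.
Qed.

End Euclidean.

(** * Convex differentiable functions *)

Section ConvexSmooth.
Context {R : realType} {n : nat}.
Implicit Types (h : 'rV[R]_n -> R^o) (u v x y : 'rV[R]_n).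

Lemma convex_functionE h :
  convex_function [set: convex_lmodType 'rV[R]_n] h ->
  forall t u v, 0 <= t <= 1 -> h (t *: u + (1 - t) *: v) <= t * h u + (1 - t) * h v.
Proof.
move=> hconv t u v /andP[t0 t1].
exact: (hconv (Itv01 t0 t1) u v (in_setT _) (in_setT _)).
Qed.

Lemma derive_grad h x v : differentiable h x -> 'D_v h x = dot v (grad h x).
Proof.
move=> dh; rewrite deriveE// {1}(row_sum_delta v) linear_sum/=.
by apply: eq_bigr => j _; rewrite linearZ/= mxE deriveE.
Qed.

(** Convexity bounds each difference quotient along the segment from [x] to [y] by [h y - h x], and
    the bound survives the limit at [0] from the right. *)
Lemma convex_ge_linearization h x y :
  convex_function [set: convex_lmodType 'rV[R]_n] h -> differentiable h x ->
  h x + dot (y - x) (grad h x) <= h y.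
Proof.
move=> hconv dh; rewrite -lerBrDl -derive_grad//.
have /cvg_dnbhs_at_right dcvg := diff_derivable (v := y - x) dh.
apply: (cvgr_to_le dcvg); near=> t.
have t0 : 0 < t by near: t; exact: nbhs_right_gt.
have t1 : t <= 1 by near: t; exact: nbhs_right_le.
have txy : t *: (y - x) + x = t *: y + (1 - t) *: x.
  by rewrite scalerBr scalerBl scale1r addrAC addrA.
rewrite /= txy -[_ *: _]/(_ * _) mulrC ler_pdivrMr// lerBlDr.
have t01 : 0 <= t <= 1 by rewrite ltW.
apply: (le_trans (convex_functionE hconv y x t01)).
by rewrite le_eqVlt; apply/orP; left; apply/eqP; ring.
Unshelve. all: by end_near. Qed.

(* Convexity bounds the linearization error by
   [dot (y - x) (grad h y - grad h x)], so near the diagonal the local Lipschitz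
   constant of the gradient suffices; away from it the error is bounded and
   [enorm (y - x)] is bounded below. *)
Lemma convex_le_quadratic h (K : set 'rV[R]_n) :
  convex_function [set: convex_lmodType 'rV[R]_n] h ->
  continuously_differentiable h -> locally_lipschitz (grad h) -> compact K ->
  exists2 L : R, 0 < L & forall x y, K x -> K y ->
    h y <= h x + dot (y - x) (grad h x) + L * enorm (y - x) ^+ 2.
Proof.
move=> hconv [dh cgrad] lgrad cK.
have /compact_near_coveringP cover := compact_setX cK cK.
pose P (L : R) (z : 'rV[R]_n * 'rV[R]_n) :=
  h z.2 <= h z.1 + dot (z.2 - z.1) (grad h z.1) + L * enorm (z.2 - z.1) ^+ 2.
suff : \forall L \near +oo, K `*` K `<=` P L.
  move=> nearP; near (@pinfty_nbhs R) => L.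
  exists L; first by near: L; exact: nbhs_pinfty_gt.
  move=> x y Kx Ky.
  have : K `*` K `<=` P L by near: L.
  by move=> /(_ (x, y)); exact.
apply: cover => -[x y] /= [Kx Ky].
have [->{y Ky}|xy] := eqVneq y x.
  have [L0 [U Ux UL]] := lgrad x.
  near=> z L => /=; rewrite /P.
  have U1 : U z.1 by near: z; exact: (@cvg_fst _ _ (nbhs x) (nbhs x) _ U).
  have U2 : U z.2 by near: z; exact: (@cvg_snd _ _ (nbhs x) (nbhs x) _ U).
  have L1 : 1 <= L by near: L; exact: nbhs_pinfty_ge (num_real _).
  have L0L : L0 <= L by near: L; exact: nbhs_pinfty_ge (num_real _).
  have := convex_ge_linearization (x := z.2) z.1 hconv (dh _).
  have : dot (z.2 - z.1) (grad h z.2 - grad h z.1) <= L * enorm (z.2 - z.1) ^+ 2.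
    apply: dot_le; first exact: lt_le_trans L1.
    by rewrite (le_trans (UL _ _ U2 U1))// ler_wpM2r ?enorm_ge0.
  have -> : z.1 - z.2 = (-1) *: (z.2 - z.1) by rewrite scaleN1r opprB.
  rewrite dotBr dotZl; lra.
set q := fun z : 'rV[R]_n * 'rV[R]_n =>
  h z.2 - h z.1 - dot (z.2 - z.1) (grad h z.1).
have cvg_q : q z @[z --> (x, y)] --> q (x, y).
  have hcvg := fun w => differentiable_continuous (dh w).
  apply: cvgB; first apply: cvgB.
  - by apply: (cvg_comp snd h) (hcvg y); exact: cvg_snd.
  - by apply: (cvg_comp fst h) (hcvg x); exact: cvg_fst.
  - apply: dot_cvg; first by apply: cvgB; [exact: cvg_snd|exact: cvg_fst].
    by apply: (cvg_comp fst (grad h)) (cgrad x); exact: cvg_fst.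
have cvg_d : enorm (z.2 - z.1) ^+ 2 @[z --> (x, y)] --> enorm (y - x) ^+ 2.
  by apply: enorm_cvg; apply: cvgB; [exact: cvg_snd|exact: cvg_fst].
have d_gt0 : 0 < enorm (y - x) ^+ 2.
  rewrite exprn_gt0// lt_neqAle enorm_ge0 andbT eq_sym.
  by apply: contra xy => /eqP/enorm_eq0/eqP; rewrite subr_eq0.
set d := enorm (y - x) ^+ 2 in d_gt0 cvg_d.
near=> z L => /=; rewrite /P.
have qz : q z <= q (x, y) + 1.
  by near: z; apply: (cvgr_le _ cvg_q); rewrite ltrDl.
have dz : d / 2 <= enorm (z.2 - z.1) ^+ 2.
  by near: z; apply: (cvgr_ge _ cvg_d); lra.
have L0 : 0 <= L by near: L; exact: nbhs_pinfty_ge (num_real _).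
have : (q (x, y) + 1) / (d / 2) <= L by near: L; exact: nbhs_pinfty_ge (num_real _).
rewrite ler_pdivrMr ?divr_gt0// => qL.
have : L * (d / 2) <= L * enorm (z.2 - z.1) ^+ 2 by rewrite ler_wpM2l.
move: qz; rewrite {1}/q; lra.
Unshelve. all: by end_near. Qed.

End ConvexSmooth.

(** * Convexity, monotonicity and semicontinuity of extended-valued functions *)

Section ExtendedReal.
Context {R : realType} {m : nat}.
Implicit Types (g : 'rV[R]_m -> \bar R) (u v : 'rV[R]_m).

Lemma econvex_le g (t : R) u v a b : econvex g -> 0 <= t <= 1 ->
  (g u <= a%:E)%E -> (g v <= b%:E)%E ->
  (g (t *: u + (1 - t) *: v)%R <= (t * a + (1 - t) * b)%:E)%E.
Proof.
move=> gconv /[dup] t01 /andP[t0 t1] gu gv; apply: le_trans (gconv t u v t01) _.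
by rewrite [leRHS]EFinD !EFinM leeD// lee_wpmul2l// lee_fin// subr_ge0.
Qed.

Lemma nondecreasing_le g (A : 'I_m -> Prop) u v :
  (forall i, ~ A i -> nondecreasing_in i g) ->
  (forall i, A i -> u 0 i = v 0 i) -> (forall i, u 0 i <= v 0 i) ->
  (g u <= g v)%E.
Proof.
move=> gmono uvA uv.
pose w k : 'rV[R]_m := \row_i if (i < k)%N then v 0 i else u 0 i.
have gw k : (k <= m)%N -> (g u <= g (w k))%E.
  elim: k => [_|k IH km].
    by rewrite (_ : w 0%N = u)//; apply/rowP => i; rewrite mxE.
  apply: (le_trans (IH (ltnW km))).
  pose ik := Ordinal km.
  have wE j : j != ik -> w k 0 j = w k.+1 0 j.
    rewrite !mxE ltnS [in RHS]leq_eqVlt -(inj_eq val_inj)/= => /negPf ->.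
    by [].
  have [Aik|nAik] := pselect (A ik).
    rewrite (_ : w k.+1 = w k)//; apply/rowP => j; have [->|/wE//] := eqVneq j ik.
    by rewrite !mxE /= ltnn ltnS leqnn uvA.
  by apply: (gmono ik nAik) => //; rewrite !mxE/= ltnn ltnS leqnn.
apply: (le_trans (gw m (leqnn m))); rewrite (_ : w m = v)//.
by apply/rowP => i; rewrite mxE ltn_ord.
Qed.

Lemma lower_semicontinuous_comp (T : topologicalType) (h : T -> 'rV[R]_m) g :
  lower_semicontinuous g -> continuous h -> lower_semicontinuous (g \o h).
Proof.
move=> glsc hcont t a /glsc[V htV Va].
by exists (h @^-1` V) => [|s]; [exact: hcont|exact: Va].
Qed.

End ExtendedReal.

(** * Linearization and quadratic model of the inner map *)

Section Model.
Context {R : realType} {n m : nat}.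
Variable f : 'I_m -> 'rV[R]_n -> R^o.
Hypothesis f_convex :
  forall i, convex_function [set: convex_lmodType 'rV[R]_n] (f i).
Hypothesis f_C1 : forall i, continuously_differentiable (f i).
Implicit Types (x y z : 'rV[R]_n) (a b : 'rV[R]_m).

Definition linearization x y : 'rV[R]_m :=
  vecfun f x + (y - x) *m 'J (vecfun f) x.

Lemma modelE a x y :
  model f a x y = linearization x y + (enorm (y - x) ^+ 2 / 2) *: a.
Proof. by []. Qed.

Lemma linearization_id x : linearization x x = vecfun f x.
Proof. by rewrite /linearization subrr mul0mx addr0. Qed.

Lemma model_id a x : model f a x x = vecfun f x.
Proof.
by rewrite modelE linearization_id subrr enorm0 expr0n/= mul0r scale0r addr0.
Qed.

Lemma differentiable_vecfun x : differentiable (vecfun f) x.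
Proof.
have -> : vecfun f = \sum_(i < m) (fun y => f i y *: delta_mx 0 i : 'rV[R]_m).
  apply/funext => y; rewrite fct_sumE [LHS]row_sum_delta.
  by apply: eq_bigr => i _; rewrite mxE.
apply: differentiable_sum => i; apply: differentiableZl.
by have [] := f_C1 i.
Qed.

Lemma linearization_coord x y i :
  linearization x y 0 i = f i x + dot (y - x) (grad (f i) x).
Proof.
have [dfi _] := f_C1 i.
have dF := differentiable_vecfun x.
rewrite /linearization mxE [X in X + _]mxE -derive_grad//; congr (_ + _).
rewrite -deriveEjacobian// derive_mx; last exact: diff_derivable.
have -> : f i = (fun z => vecfun f z 0 i) by apply/funext => z; rewrite [RHS]mxE.
exact: mxE.
Qed.

Lemma linearization_conv x y z t :
  linearization x (t *: y + (1 - t) *: z) =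
  t *: linearization x y + (1 - t) *: linearization x z.
Proof.
apply/rowP => i; rewrite linearization_coord.
rewrite mxE [X in _ = X + _]mxE [X in _ = _ + X]mxE !linearization_coord.
have -> : t *: y + (1 - t) *: z - x = t *: (y - x) + (1 - t) *: (z - x).
  by apply/rowP => j; rewrite !mxE; ring.
by rewrite [in LHS]dotDl !dotZl; ring.
Qed.

Lemma linearization_le x y i : linearization x y 0 i <= f i y.
Proof.
by rewrite linearization_coord convex_ge_linearization//; have [] := f_C1 i.
Qed.

Lemma linearization_affine x y i :
  affine (f i) -> linearization x y 0 i = f i y.
Proof.
move=> [l [b fE]]; apply/eqP; rewrite eq_le linearization_le/=.
(* At the reflection of [y] through [x] the increments of an affine function change sign, so the
   gradient inequality there is the missing reverse one. *)
have := linearization_le x (2 *: x - y) i; rewrite !linearization_coord !fE.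
rewrite linearB linearZ/=.
have -> : 2 *: x - y - x = (-1) *: (y - x).
  by apply/rowP => j; rewrite !mxE; ring.
rewrite dotZl -[2 *: l x]/(2 * l x); lra.
Qed.

Lemma linearization_continuous :
  continuous (fun w : 'rV[R]_n * 'rV[R]_n => linearization w.1 w.2).
Proof.
move=> [x y]; apply: cvg_row => i /=.
under eq_fun do rewrite linearization_coord.
rewrite linearization_coord; have [dfi gfi] := f_C1 i.
apply: cvgD.
  by apply: (cvg_comp fst (f i)) (differentiable_continuous (dfi x)); exact: cvg_fst.
apply: dot_cvg; first by apply: cvgB; [exact: cvg_snd|exact: cvg_fst].
by apply: (cvg_comp fst (grad (f i))) (gfi x); exact: cvg_fst.
Qed.

Lemma model_continuous a :
  continuous (fun w : 'rV[R]_n * 'rV[R]_n => model f a w.1 w.2).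
Proof.
move=> w; apply: cvgD; first exact: linearization_continuous.
apply: cvgZr_tmp; apply: cvgMr_tmp; apply: enorm_cvg.
by apply: cvgB; [exact: cvg_snd|exact: cvg_fst].
Qed.

Lemma vecfun_continuous : continuous (vecfun f).
Proof. by move=> x; exact/differentiable_continuous/differentiable_vecfun. Qed.

Variable g : 'rV[R]_m -> \bar R.
Hypothesis g_convex : econvex g.
Hypothesis g_mono : forall i, ~ affine (f i) -> nondecreasing_in i g.

(** Where [f i] is affine the linearization is exact; elsewhere it lies below [f i] and [g] is
    nondecreasing in that coordinate. *)
Lemma linearization_value_le x y u :
  (g (linearization x y + u)%R <= g (vecfun f y + u)%R)%E.
Proof.
apply: (nondecreasing_le g_mono) => i.
  by move=> fi; rewrite mxE [RHS]mxE [X in _ = X + _]mxE linearization_affine.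
by rewrite mxE [leRHS]mxE lerD2r [leRHS]mxE; exact: linearization_le.
Qed.

Lemma step_sizes_ok_value_le a x y : Gamma f a -> step_sizes_ok f a x y ->
  (g (vecfun f y) <= g (model f a x y))%E.
Proof.
move=> aG ok; apply: (nondecreasing_le g_mono) => // i fi.
have [_ /(_ fi) ai _] := aG i.
rewrite modelE [RHS]mxE linearization_affine// [LHS]mxE.
by rewrite [X in _ = _ + X]mxE ai mulr0 addr0.
Qed.

(** The weights are not tied to [enorm (y - x) ^+ 2 / 2], so that the lemma also covers the lifted
    subproblem and the Slater point. In affine coordinates both step sizes vanish. *)
Lemma model_value_le a b (s t : R) x y : Gamma f a -> Gamma f b -> vle a b ->
  0 <= s <= t ->
  (g (linearization x y + s *: a)%R <= g (linearization x y + t *: b)%R)%E.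
Proof.
move=> aG bG ab /andP[s0 st]; apply: (nondecreasing_le g_mono) => i.
  move=> fi; have [_ /(_ fi) ai _] := aG i; have [_ /(_ fi) bi _] := bG i.
  by rewrite !mxE ai bi !mulr0.
rewrite mxE [leRHS]mxE lerD2l mxE [leRHS]mxE.
by have [a0 _ _] := aG i; rewrite ler_pM.
Qed.

(** Convexity of [g] leaves the weight [t] on the quadratic term, whereas the model at the
    intermediate point carries only [t ^+ 2 <= t]. Sublevel sets of the model that contain [x] are
    thus star-shaped around [x]. *)
Lemma model_segment_le a x y t (c : R) : Gamma f a -> 0 <= t <= 1 ->
  (g (vecfun f x) <= c%:E)%E -> (g (model f a x y) <= c%:E)%E ->
  (g (model f a x (x + t *: (y - x))%R) <= c%:E)%E.
Proof.
move=> aG /[dup] t01 /andP[t0 t1] gx gy.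
have -> : c = t * c + (1 - t) * c by ring.
apply: le_trans (econvex_le g_convex t01 gy gx).
have -> : t *: model f a x y + (1 - t) *: vecfun f x =
    linearization x (x + t *: (y - x)) + (t * (enorm (y - x) ^+ 2 / 2)) *: a.
  have -> : x + t *: (y - x) = t *: y + (1 - t) *: x.
    by apply/rowP => j; rewrite !mxE; ring.
  by rewrite linearization_conv linearization_id modelE scalerDr scalerA addrAC.
rewrite modelE; apply: model_value_le => //.
have -> : x + t *: (y - x) - x = t *: (y - x) by rewrite addrAC subrr add0r.
rewrite enormZ// divr_ge0 ?sqr_ge0//= exprMn -mulrA ler_wpM2r ?divr_ge0 ?sqr_ge0//.
by rewrite expr2 ler_piMr.
Qed.

End Model.

(** * A Lagrange multiplier for a single convex constraint *)

Section Multiplier.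
Context {R : realType} {V : lmodType R}.

(* [E w r] is the epigraph of the objective and [c w <= 0] the constraint. For
   a single constraint the multiplier is the largest slope [(G - r) / c w] over
   the points with [0 < c w], which the points with [c w < 0] bound from above;
   no separation theorem is involved. *)
Lemma lagrange_multiplier (E : V -> R -> Prop) (c : V -> R) (G M rho : R)
    (wbar : V) :
  (forall t u v a b, 0 <= t <= 1 -> E u a -> E v b ->
     E (t *: u + (1 - t) *: v) (t * a + (1 - t) * b)) ->
  (forall t u v, 0 <= t <= 1 ->
     c (t *: u + (1 - t) *: v) <= t * c u + (1 - t) * c v) ->
  (forall w r, E w r -> c w <= 0 -> G <= r) ->
  0 < rho -> E wbar M -> c wbar <= - rho ->
  exists2 lam : R, 0 <= lam <= (M - G) / rho &
    forall w r, E w r -> G <= r + lam * c w.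
Proof.
move=> Econv cconv EG rho0 EM cM.
have slope_le u a v b : E u a -> 0 < c u -> E v b -> c v < 0 ->
    (G - a) / c u <= (b - G) / - c v.
  move=> Eua cu Evb cv.
  have d0 : 0 < c u - c v by lra.
  (* This weight makes [t * c u + (1 - t) * c v] vanish, so the combination is feasible. *)
  pose t := - c v / (c u - c v).
  have t01 : 0 <= t <= 1.
    by rewrite /t divr_ge0 ?oppr_ge0 ?(ltW d0) ?(ltW cv)//= ler_pdivrMr//; lra.
  have tE : t * (c u - c v) = - c v by rewrite mulfVK// gt_eqF.
  have := EG _ _ (Econv _ _ _ _ _ t01 Eua Evb).
  have /[swap] /[apply] : c (t *: u + (1 - t) *: v) <= 0.
    by apply: le_trans (cconv _ _ _ t01) _; nra.
  move=> GE; rewrite ler_pdivrMr// mulrAC ler_pdivlMr ?oppr_gt0//.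
  have : (c u - c v) * G <= (c u - c v) * (t * a + (1 - t) * b).
    by rewrite ler_pM2l.
  have -> : (c u - c v) * (t * a + (1 - t) * b) =
      t * (c u - c v) * a + ((c u - c v) - t * (c u - c v)) * b by ring.
  rewrite tE; lra.
(* Adding [0] makes the set nonempty and its supremum nonnegative even if no point violates the
   constraint. *)
pose A := [set 0] `|` [set s | exists u a, [/\ E u a, 0 < c u & s = (G - a) / c u]].
have GM : G <= M by apply: (EG _ _ EM); lra.
have A_ub v b : E v b -> c v < 0 -> ubound A ((b - G) / - c v).
  move=> Evb cv s [->|[u [a [Eua cu ->]]]]; last exact: slope_le.
  by rewrite divr_ge0 ?oppr_ge0 ?(ltW cv)// subr_ge0 (EG _ _ Evb (ltW cv)).
have cM0 : c wbar < 0 by lra.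
have A_sup : has_sup A.
  by split; [exists 0; left|exists ((M - G) / - c wbar); exact: A_ub].
exists (sup A).
  apply/andP; split; first by apply: sup_upper_bound => //; left.
  apply: le_trans (sup_le_ub _ (A_ub _ _ EM cM0)) _; first by case: A_sup.
  by rewrite ler_wpM2l ?subr_ge0// lef_pV2 ?posrE; lra.
move=> w r Ewr; have [cw|cw|cw] := ltgtP (c w) 0.
- have : sup A <= (r - G) / - c w by apply: sup_le_ub (A_ub _ _ Ewr cw); case: A_sup.
  by rewrite ler_pdivlMr ?oppr_gt0//; lra.
- have : (G - r) / c w <= sup A by apply: sup_upper_bound => //; right; exists w, r.
  by rewrite ler_pdivrMr//; lra.
- by rewrite cw mulr0 addr0; apply: EG Ewr _; rewrite cw.
Qed.

End Multiplier.

(** * Uniform coercivity and Fejer convergence *)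

Section Limits.
Context {R : realType} {n : nat}.

(** Semicontinuity and compactness of a sphere give [Phi x' > c] on the sphere of radius [rho]
    around every [x'] near [x]. A point of the sublevel set beyond that sphere would, by
    star-shapedness, force a value at most [c] where the segment crosses it. Compactness of [K] then
    yields one radius. *)
Lemma uniformly_coercive (Phi : 'rV[R]_n -> 'rV[R]_n -> \bar R)
    (K : set 'rV[R]_n) (c : R) :
  compact K ->
  lower_semicontinuous (fun w : 'rV[R]_n * 'rV[R]_n => Phi w.1 w.2) ->
  (forall x y t, K x -> 0 <= t <= 1 -> (Phi x y <= c%:E)%E ->
     (Phi x (x + t *: (y - x))%R <= c%:E)%E) ->
  (forall x, K x -> coercive (Phi x)) ->
  exists r : R, forall x y, K x -> (Phi x y <= c%:E)%E -> enorm (y - x) <= r.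
Proof.
move=> cK Philsc Phiseg Phicoer.
have /compact_near_coveringP cover := cK.
pose P (r : R) x := K x -> forall y, (Phi x y <= c%:E)%E -> enorm (y - x) <= r.
suff : \forall r \near +oo, K `<=` P r.
  move=> nearP; near (@pinfty_nbhs R) => r; exists r => x y Kx.
  have KP : K `<=` P r by near: r.
  exact: (KP x Kx Kx).
apply: cover => x Kx.
have [r0 r0P] := Phicoer x Kx (c + 1).
pose r1 := Num.max 1 r0.
have [r11 r10] : 1 <= r1 /\ r0 <= r1 by rewrite /r1 !le_max !lexx orbT.
(* With this radius [enorm d = rho] implies [enorm (x + d) >= r1 >= r0]; the maximum with [1] keeps
   [rho] positive. *)
pose rho := Num.sqrt (2 * r1 ^+ 2 + 2 * enorm x ^+ 2).
have rho2 : rho ^+ 2 = 2 * r1 ^+ 2 + 2 * enorm x ^+ 2.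
  by rewrite sqr_sqrtr// addr_ge0// mulr_ge0 ?sqr_ge0.
have rho0 : 0 < rho.
  rewrite sqrtr_gt0; have := sqr_ge0 (enorm x).
  have : 1 <= r1 ^+ 2 by rewrite expr_ge1//; lra.
  lra.
pose S := [set d : 'rV[R]_n | enorm d = rho].
have cS : compact S.
  apply: (@enorm_bounded_compact _ _ _ rho) => [u ->//|].
  apply: (@preimage_closed _ _ (@enorm R n) [set rho]); last exact: closed_eq.
  by move=> u _; exact: enorm_continuous.
have /compact_near_coveringP coverS := cS.
have PS : \forall x' \near x, S `<=` [set d | (c%:E < Phi x' (x' + d)%R)%E].
  apply: (coverS _ (nbhs x) (fun x' d => (c%:E < Phi x' (x' + d)%R)%E)) => d Sd.
  have : (c%:E < Phi x (x + d)%R)%E.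
    apply: (@lt_le_trans _ _ (c + 1)%:E); first by rewrite lte_fin ltrDl.
    apply: r0P; apply: (le_trans r10).
    rewrite -(@ler_pXn2r _ 2)// ?nnegrE ?enorm_ge0//; last by lra.
    have := enormB_sqr_le d (- x); rewrite opprK [d + x]addrC.
    rewrite enormN Sd rho2; lra.
  move=> /(Philsc (x, x + d)) [W xW WP].
  have : \forall w \near (d, x), W (w.2, w.2 + w.1).
    have c1 : w.2 @[w --> (d, x)] --> x by exact: cvg_snd.
    have c2 : w.2 + w.1 @[w --> (d, x)] --> x + d.
      by apply: cvgD; [exact: cvg_snd|exact: cvg_fst].
    exact: (cvg_pair c1 c2).
  by apply: filterS => w /WP.
near=> x' r => /=; rewrite /P => Kx' y Phiy.
have rhor : rho <= r by near: r; exact: nbhs_pinfty_ge (num_real _).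
apply: (le_trans _ rhor); rewrite leNgt; apply/negP => ylarge.
have e0 : 0 < enorm (y - x') by exact: lt_trans ylarge.
pose t := rho / enorm (y - x').
have t01 : 0 <= t <= 1.
  by rewrite /t divr_ge0 ?(ltW rho0) ?enorm_ge0//= ler_pdivrMr// mul1r ltW.
have Sd : S (t *: (y - x')).
  rewrite /S/= enormZ; last by case/andP: t01.
  by rewrite /t mulfVK// gt_eqF.
have : (c%:E < Phi x' (x' + t *: (y - x'))%R)%E.
  have : S `<=` [set d | (c%:E < Phi x' (x' + d)%R)%E] by near: x'.
  exact.
by rewrite ltNge => /negP; apply; exact: Phiseg.
Unshelve. all: by end_near. Qed.

(** Telescoping the step inequality at [s0] and using monotonicity bounds [k.+1 * (v k - vmin)], so
    the values tend to [vmin]. A cluster point is then a minimizer by semicontinuity, and the Fejer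
    property with respect to that point gives convergence. *)
Lemma fejer_cvg (phi : 'rV[R]_n -> \bar R) (x : nat -> 'rV[R]_n)
    (K : set 'rV[R]_n) (Lam vmin : R) (s0 : 'rV[R]_n) :
  compact K -> (forall k, K (x k)) -> lower_semicontinuous phi -> 0 < Lam ->
  (forall u, (vmin%:E <= phi u)%E) -> phi s0 = vmin%:E ->
  (forall k, (phi (x k.+1) <= phi (x k))%E) ->
  (forall k s, phi s = vmin%:E ->
     (phi (x k.+1) <=
      (vmin + Lam * (enorm (x k - s) ^+ 2 - enorm (x k.+1 - s) ^+ 2))%:E)%E) ->
  exists2 xs, argmin phi xs & x @ \oo --> xs.
Proof.
move=> cK Kx philsc Lam0 vle phis0 phidec step.
have fejer k s : phi s = vmin%:E -> enorm (x k.+1 - s) <= enorm (x k - s).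
  move=> /(step k)/(le_trans (vle _)); rewrite lee_fin lerDl pmulr_rge0// subr_ge0.
  by rewrite ler_sqr ?nnegrE ?enorm_ge0.
(* The index is shifted because finiteness comes from the step inequality, which does not control
   [phi (x 0)]. *)
pose v k := fine (phi (x k.+1)).
have vE k : phi (x k.+1) = (v k)%:E.
  rewrite fineK// fin_numElt (lt_le_trans (ltNyr _) (vle _))/=.
  exact: le_lt_trans (step k s0 phis0) (ltry _).
pose d k := enorm (x k - s0) ^+ 2.
have dv k : v k <= vmin + Lam * (d k - d k.+1) by rewrite -lee_fin -vE step.
have vdec k : v k.+1 <= v k by rewrite -lee_fin -!vE.
have vmin_le k : vmin <= v k by rewrite -lee_fin -vE.
have sum_le k : k.+1%:R * (v k - vmin) <= Lam * (d 0%N - d k.+1).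
  elim: k => [|k IH]; first by have := dv 0%N; lra.
  have := dv k.+1; have := vdec k; rewrite -[k.+2]addn1 natrD mulrDl mul1r => vk dk.
  have : k.+1%:R * (v k.+1 - vmin) <= k.+1%:R * (v k - vmin).
    by rewrite ler_wpM2l// lerB.
  lra.
have [p [Kp clp]] : K `&` cluster (x @ \oo) !=set0.
  by apply: cK; exists 0%N => // k _; exact: Kx.
have clk (A : set 'rV[R]_n) N : nbhs p A -> exists2 k, (N <= k)%N & A (x k).
  move=> pA; have xN : (x @ \oo) (x @` [set k | (N <= k)%N]).
    by exists N => // k Nk; exists k.
  by have [_ [[k Nk <-] Ak]] := clp _ _ xN pA; exists k.
have phip : phi p = vmin%:E.
  apply/eqP; rewrite eq_le vle andbT; apply/lee_addgt0Pr => e e0.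
  rewrite leNgt; apply/negP => /philsc[W pW WP].
  (* Beyond this index a gap larger than [e] contradicts [sum_le], yet the sequence returns to the
     neighbourhood [W] at arbitrarily late indices. *)
  have [N NP] : exists N, Lam * d 0%N / e < N.+1%:R.
    exists (Num.truncn (Lam * d 0%N / e)); exact: truncnS_gt.
  have [[|k] // Nk /WP] := clk W N.+1 pW.
  rewrite vE lte_fin => ek.
  have : k.+1%:R * e < k.+1%:R * (v k - vmin) by rewrite ltr_pM2l ?ltr0n//; lra.
  have := sum_le k; have : 0 <= d k.+1 by exact: sqr_ge0.
  have : N.+1%:R * e <= k.+1%:R * e by rewrite ler_pM2r// ler_nat.
  move: NP; rewrite ltr_pdivrMr//; nra.
exists p; first by move=> u; rewrite phip.
apply/cvgrPdist_lt => e e0.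
have [|N _ xN] := clk [set u | enorm (u - p) < e] 0%N.
  have ecvg : enorm (u - p) @[u --> p] --> (0 : R).
    rewrite -(@enorm0 _ n) -[X in enorm X](subrr p).
    apply: (cvg_comp (fun u => u - p)); last exact: enorm_continuous.
    by apply: (@cvgB _ _ _ (nbhs p) _ id (cst p)); [exact: cvg_id|exact: cvg_cst].
  exact: (cvgr_lt _ ecvg).
exists N => // k /= /subnK <-; rewrite distrC.
apply: le_lt_trans (normr_le_enorm _) _.
by elim: (k - N)%N => // j; apply: le_lt_trans; exact: fejer.
Qed.

End Limits.

(** * One iteration of the method *)

Section Step.
Context {R : realType} {n m : nat}.
Variables (f : 'I_m -> 'rV[R]_n -> R^o) (g : 'rV[R]_m -> \bar R).
Hypothesis f_convex :
  forall i, convex_function [set: convex_lmodType 'rV[R]_n] (f i).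
Hypothesis f_C1 : forall i, continuously_differentiable (f i).
Hypothesis g_convex : econvex g.
Hypothesis g_mono : forall i, ~ affine (f i) -> nondecreasing_in i g.
Implicit Types (x y z p : 'rV[R]_n) (a b : 'rV[R]_m).

Let conv_addZ (t r s : R) (u v a : 'rV[R]_m) :
  t *: (u + r *: a) + (1 - t) *: (v + s *: a) =
  t *: u + (1 - t) *: v + (t * r + (1 - t) * s) *: a.
Proof. by apply/rowP => i; rewrite !mxE; ring. Qed.

(* The proximal subproblem is minimized at [p], so it is the problem of
   minimizing [g (linearization f x z + s *: a)] over pairs [(z, s)] with
   [enorm (z - x) ^+ 2 / 2 <= s]. Its multiplier yields the inequality without
   [enorm (z - p) ^+ 2]; that term is gained by testing it at the points of the
   segment from [p] to [z] and letting them tend to [p]. *)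
Lemma multiprox_three_points a x p zbar (G M rho sbar : R) :
  Gamma f a -> multiprox g f a x p -> g (model f a x p) = G%:E ->
  0 < rho -> enorm (zbar - x) ^+ 2 / 2 + rho <= sbar ->
  (g (linearization f x zbar + sbar *: a)%R <= M%:E)%E ->
  exists2 lam : R, 0 <= lam <= (M - G) / rho &
    forall z r, (g (vecfun f z) <= r%:E)%E ->
      G <= r + lam * ((enorm (z - x) ^+ 2 - enorm (z - p) ^+ 2) / 2).
Proof.
move=> aG pmin pG rho0 sbarP gM.
pose E (w : 'rV[R]_n * R^o) r := (g (linearization f x w.1 + w.2 *: a)%R <= r%:E)%E.
pose c (w : 'rV[R]_n * R^o) := enorm (w.1 - x) ^+ 2 / 2 - w.2.
have Econv t u v r s : 0 <= t <= 1 -> E u r -> E v s ->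
    E (t *: u + (1 - t) *: v) (t * r + (1 - t) * s).
  move=> t01 Eu Ev; apply: le_trans (econvex_le g_convex t01 Eu Ev).
  by rewrite /= linearization_conv// conv_addZ.
have [|w r Ewr cw||||lam lamP lamE] :=
    @lagrange_multiplier _ _ E c G M rho (zbar, sbar) Econv.
- move=> t u v /andP[t0 t1]; rewrite /c /= enorm_sqr_conv.
  have : 0 <= t * (1 - t) * enorm (u.1 - v.1) ^+ 2.
    by rewrite mulr_ge0 ?sqr_ge0// mulr_ge0// subr_ge0.
  rewrite -[t *: u.2]/(t * u.2) -[(1 - t) *: v.2]/((1 - t) * v.2); lra.
- rewrite -lee_fin -pG; apply: le_trans (pmin w.1) _; apply: le_trans Ewr.
  rewrite modelE; apply: (model_value_le g_mono) => //.
  by rewrite divr_ge0 ?sqr_ge0//= -subr_le0.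
- exact: rho0.
- exact: gM.
- by rewrite /c /= ; lra.
exists lam => // z r gz.
have [lam0 _] := andP lamP.
set X := r + _; rewrite leNgt; apply/negP => XG.
set Y := lam * (enorm (z - p) ^+ 2 / 2).
have Y0 : 0 <= Y by rewrite mulr_ge0// divr_ge0 ?sqr_ge0.
have t_le t : 0 < t -> t <= 1 -> G <= X + t * Y.
  move=> t0 t1; have t01 : 0 <= t <= 1 by rewrite (ltW t0).
  have Ez : E (z, 0) r.
    rewrite /E /= scale0r addr0; apply: le_trans gz.
    by have := linearization_value_le f_convex f_C1 g_mono x z 0; rewrite !addr0.
  have Ep : E (p, enorm (p - x) ^+ 2 / 2) G by rewrite /E /= -modelE pG.
  have := lamE _ _ (Econv t _ _ _ _ t01 Ez Ep).
  rewrite /c /= enorm_sqr_conv.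
  rewrite -[t *: 0]/(t * 0) -[(1 - t) *: (_ / 2)]/((1 - t) * _) => GE.
  (* The constraint is tight at [p], so the terms in [enorm (p - x)] cancel and what remains is
     divisible by [t]. *)
  have : t * G <= t * (X + t * Y).
    rewrite /X /Y; lra.
  by rewrite ler_pM2l.
pose d := G - X; have d0 : 0 < d by rewrite subr_gt0.
have D0 : 0 < d + Y + 1 by lra.
(* This [t] lies in the unit interval and makes [t * Y] smaller than the supposed gap [d]. *)
have := t_le (d / (d + Y + 1)) (divr_gt0 d0 D0).
rewrite ler_pdivrMr// mul1r => /(_ ltac:(lra)).
have : d / (d + Y + 1) * Y < d.
  rewrite mulrAC ltr_pdivrMr//; nra.
rewrite /d; lra.
Qed.

(** Contracting [y] towards [x] scales the squared distance by [t ^+ 2], while convexity scales the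
    shift [t * (B + 1)] only by [t]. The resulting weight [t ^+ 2 * (B + 1)] covers the quadratic
    term and leaves the slack [t ^+ 2], whatever [x] is. *)
Lemma slater_value_le a b x y (B t c r : R) : Gamma f a -> Gamma f b ->
  vle a b -> 0 <= t <= 1 -> enorm (y - x) ^+ 2 / 2 <= B ->
  (g (vecfun f x) <= c%:E)%E ->
  (g (vecfun f y + (t * (B + 1)) *: b)%R <= r%:E)%E ->
  (g (linearization f x (t *: y + (1 - t) *: x) +
      (enorm (t *: y + (1 - t) *: x - x) ^+ 2 / 2 + t ^+ 2) *: a)%R
    <= (t * r + (1 - t) * c)%:E)%E.
Proof.
move=> aG bG ab /[dup] t01 /andP[t0 t1] yB gx gy.
have gly := le_trans (linearization_value_le f_convex f_C1 g_mono x y _) gy.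
apply: le_trans (econvex_le g_convex t01 gly gx).
have -> : t *: (linearization f x y + (t * (B + 1)) *: b) + (1 - t) *: vecfun f x =
    linearization f x (t *: y + (1 - t) *: x) + (t ^+ 2 * (B + 1)) *: b.
  rewrite linearization_conv// linearization_id -[vecfun f x in LHS]addr0.
  by rewrite -(scale0r b) conv_addZ mulr0 addr0 mulrA expr2.
apply: (model_value_le g_mono) => //.
have -> : t *: y + (1 - t) *: x - x = t *: (y - x).
  by apply/rowP => j; rewrite !mxE; ring.
rewrite enormZ// addr_ge0 ?divr_ge0 ?sqr_ge0//=.
rewrite exprMn -mulrA -[X in _ + X <= _]mulr1 -mulrDr ler_wpM2l ?sqr_ge0//.
by rewrite lerD2r.
Qed.

(** An upper bound proportional to [alpha0] keeps the affine coordinates at [0], so the whole range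
    stays in [Gamma]. *)
Definition step_size_range (alpha0 : 'rV[R]_m) (C : R) : set 'rV[R]_m :=
  [set a | vle alpha0 a /\ vle a (C *: alpha0)].

Lemma step_size_range_Gamma alpha0 C a :
  Gamma f alpha0 -> step_size_range alpha0 C a -> Gamma f a.
Proof.
move=> aG [lo up] i; have [a0 aff naff] := aG i; split.
- exact: le_trans (lo i).
- move=> fi; have := lo i; have := up i; rewrite mxE aff// mulr0 => ? ?.
  by apply/le_anti/andP.
- by move=> /naff a0i; exact: lt_le_trans (lo i).
Qed.

Lemma multiprox_value_le a x y : multiprox g f a x y ->
  (g (model f a x y) <= g (vecfun f x))%E.
Proof. by move=> /(_ x); rewrite model_id. Qed.

(** The range is preserved by induction on the backtracking loop: a coordinate is multiplied by
    [eta] only if its own test fails, and then the hypothesis bounds the result. *)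
Lemma multiprox_stepP alpha0 C eta x a x' a' : 1 <= eta -> Gamma f alpha0 ->
  step_size_range alpha0 C a ->
  (forall b y i, step_size_range alpha0 C b -> multiprox g f b x y ->
     model f b x y 0 i < f i y -> eta * b 0 i <= C * alpha0 0 i) ->
  multiprox_step g f eta x a x' a' ->
  [/\ step_size_range alpha0 C a', multiprox g f a' x x',
      (g (vecfun f x') <= g (model f a' x x'))%E &
      argmin (g \o vecfun f) x -> x' = x].
Proof.
move=> eta1 alpha0G aR enlarge_le [xt [bt ok xid xnew]].
have {bt} [a'R xtP] : step_size_range alpha0 C a' /\ multiprox g f a' x xt.
  elim: bt {ok xid xnew} => {a' xt} [xt|b xt xt' _ [bR xtP] _ xt'P]; first by [].
  split=> //; have [lo up] := bR; split=> i; rewrite /enlarge mxE.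
    case: ifP => // _; apply: le_trans (lo i) _; rewrite ler_peMl//.
    by have [a0 _ _] := alpha0G i; exact: le_trans (lo i).
  case: ifP => [lt_f|_]; last exact: up.
  by rewrite mxE; exact: enlarge_le bR xtP lt_f.
have a'G := step_size_range_Gamma alpha0G a'R.
have Fxt := step_sizes_ok_value_le f_convex f_C1 g_mono a'G ok.
have [xx|nxx] := pselect (multiprox g f a' x x).
  by rewrite (xid xx); split => //; rewrite model_id.
(* If [x] minimizes the objective, its value is at most that at [xt], hence at most the minimum of
   the model; so [x] would solve the subproblem. *)
rewrite (xnew nxx); split=> // xmin; case: nxx => y; rewrite model_id.
by apply: le_trans (xmin xt) _; apply: le_trans Fxt (xtP y).
Qed.

End Step.

(** * Compact sublevel sets and bounds on the step sizes *)

Section Bounds.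
Context {R : realType} {n m : nat}.

Lemma sublevel_compact (phi : 'rV[R]_n -> \bar R) (c : R) :
  lower_semicontinuous phi -> coercive phi -> compact [set x | (phi x <= c%:E)%E].
Proof.
move=> /lower_semicontinuousP philsc phicoer; have [r rP] := phicoer (c + 1).
apply: (@enorm_bounded_compact _ _ _ r) => [x /= xc|].
  rewrite leNgt; apply/negP => /ltW/rP/le_trans/(_ xc).
  by rewrite lee_fin gerDl ler10.
rewrite (_ : [set x | _] = ~` [set x | (c%:E < phi x)%E]).
  exact/open_closedC/philsc.
by apply/seteqP; split => x /=; rewrite leNgt => /negP.
Qed.

Lemma interior_edom_shift (g : 'rV[R]_m -> \bar R) (u v : 'rV[R]_m) :
  interior (edom g) u -> exists2 t : R, 0 < t <= 1 & edom g (u + t *: v).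
Proof.
move=> gu; have : u + t *: v @[t --> (0 : R)] --> u + 0 *: v.
  by apply: cvgD; [exact: cvg_cst|apply: cvgZr_tmp; exact: cvg_id].
rewrite scale0r addr0 => ucvg.
have : \forall t \near (0:R)^'+, edom g (u + t *: v).
  by apply: cvg_within; exact: ucvg.
move=> gt; near (0 : R)^'+ => t; exists t; last by near: t.
by apply/andP; split; near: t; [exact: nbhs_right_gt|exact: nbhs_right_le].
Unshelve. all: by end_near. Qed.

(** By the quadratic upper bound on [K], a test can fail only if [a 0 i <= 2 * L]; dividing
    [eta * (2 * L)] by [alpha0 0 i] gives the constant. In affine coordinates the model is exact and
    no test fails. *)
Lemma step_size_bound (f : 'I_m -> 'rV[R]_n -> R^o) (alpha0 : 'rV[R]_m)
    (eta : R) (K : set 'rV[R]_n) :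
  (forall i, convex_function [set: convex_lmodType 'rV[R]_n] (f i)) ->
  (forall i, continuously_differentiable (f i)) ->
  (forall i, locally_lipschitz (grad (f i))) ->
  Gamma f alpha0 -> 0 < eta -> compact K ->
  exists2 C : R, 1 <= C & forall a x y i, Gamma f a -> K x -> K y ->
    model f a x y 0 i < f i y -> eta * a 0 i <= C * alpha0 0 i.
Proof.
move=> f_convex f_C1 f_lip alpha0G eta0 cK.
pose P (C : R) i := forall a x y, Gamma f a -> K x -> K y ->
  model f a x y 0 i < f i y -> eta * a 0 i <= C * alpha0 0 i.
suff : \forall C \near +oo, forall i, P C i.
  move=> nearP; near (@pinfty_nbhs R) => C.
  exists C; first by near: C; exact: nbhs_pinfty_ge (num_real _).
  by move=> a x y i; have : forall i, P C i by [near: C]; apply.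
apply: filter_forall => i.
have [_ alpha0_aff alpha0_naff] := alpha0G i.
have mE a x y : model f a x y 0 i =
    linearization f x y 0 i + enorm (y - x) ^+ 2 / 2 * a 0 i.
  by rewrite modelE mxE [X in _ + X]mxE.
have [fi|nfi] := pselect (affine (f i)).
  near=> C => a x y aG _ _; rewrite mE linearization_affine//.
  by have [_ -> // _] := aG i; rewrite mulr0 addr0 ltxx.
have [L L0 LP] := convex_le_quadratic (f_convex i) (f_C1 i) (f_lip i) cK.
have a0 := alpha0_naff nfi.
near=> C => a x y aG Kx Ky; rewrite mE linearization_coord// => lt_f.
have e_ge0 : 0 <= enorm (y - x) ^+ 2 by exact: sqr_ge0.
have aL : a 0 i <= 2 * L.
  rewrite leNgt; apply/negP => aL.
  have := LP _ _ Kx Ky; nra.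
apply: (@le_trans _ _ (eta * (2 * L))); first by rewrite ler_pM2l.
rewrite -ler_pdivrMr//; near: C; exact: nbhs_pinfty_ge (num_real _).
Unshelve. all: by end_near. Qed.

End Bounds.

(** * Convergence of the generated sequence *)

Theorem theorem4 (R : realType) (n m : nat)
    (f : 'I_m -> 'rV[R]_n -> R^o) (g : 'rV[R]_m -> \bar R) (Lg : R)
    (alpha0 : 'rV[R]_m) (eta : R) (x : nat -> 'rV[R]_n)
    (f_convex : forall i, convex_function [set: convex_lmodType 'rV[R]_n] (f i))
    (f_C1 : forall i, continuously_differentiable (f i))
    (f_grad_lip : forall i, locally_lipschitz (grad (f i)))
    (g_convex : econvex g)
    (g_proper : eproper g)
    (g_lsc : lower_semicontinuous g)
    (g_lip : lipschitz_on_dom Lg g)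
    (g_mono : forall i, ~ affine (f i) -> nondecreasing_in i g)
    (alpha0_Gamma : Gamma f alpha0)
    (eta_gt1 : 1 < eta)
    (gF_proper : eproper (g \o vecfun f))
    (gF_min : argmin (g \o vecfun f) !=set0)
    (gF_int : vecfun f @^-1` interior (edom g) !=set0)
    (gF_coercive : coercive (g \o vecfun f))
    (gH_coercive : forall z, edom g (vecfun f z) ->
       coercive (fun y => g (model f alpha0 z y)))
    (x0_dom : edom g (vecfun f (x 0%N)))
    (x_gen : multiprox_sequence g f eta alpha0 x) :
  exists2 xs, argmin (g \o vecfun f) xs & x @ \oo --> xs.
Proof.
pose gF := g \o vecfun f.
have F_cont := vecfun_continuous f_C1.
have gF_lsc : lower_semicontinuous gF by exact: lower_semicontinuous_comp.
have [alpha [alpha_0 steps]] := x_gen.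
pose c0 : R := fine (gF (x 0%N)).
have x0_le : (gF (x 0%N) <= c0%:E)%E.
  by rewrite fineK// fin_numElt ltNye; have [-> _] := gF_proper.
pose K0 := [set u | (gF u <= c0%:E)%E].
have cK0 : compact K0 by exact: sublevel_compact.
have dom_K0 u : K0 u -> edom g (vecfun f u).
  by move=> /le_lt_trans; apply; exact: ltry.
have [r rP] : exists r : R, forall u y, K0 u ->
    (g (model f alpha0 u y) <= c0%:E)%E -> enorm (y - u) <= r.
  apply: (uniformly_coercive (Phi := fun u y => g (model f alpha0 u y))) => //.
  - exact: (lower_semicontinuous_comp g_lsc (@model_continuous _ _ _ _ f_C1 alpha0)).
  - by move=> u y t uK t01; exact: model_segment_le.
  - by move=> u /dom_K0; exact: gH_coercive.
have [r0 r0P] := gF_coercive (c0 + 1).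
have K0_le u : K0 u -> enorm u <= r0.
  move=> uc; rewrite leNgt; apply/negP => /ltW/r0P/le_trans/(_ uc).
  by rewrite lee_fin gerDl ler10.
(* The square root bounds any [y] within [r] of a point of [K0]; adding [r0] puts [K0] itself in the
   same ball. *)
pose rK := Num.sqrt (2 * r ^+ 2 + 2 * r0 ^+ 2) + r0.
have K0x : K0 (x 0%N) by [].
have r0_ge0 : 0 <= r0 by apply: le_trans (K0_le _ K0x); exact: enorm_ge0.
pose K := [set u : 'rV[R]_n | enorm u <= rK].
have K0K u : K0 u -> K u.
  by move=> /K0_le ur; rewrite /K/= (le_trans ur)// lerDr sqrtr_ge0.
have modelK u y : K0 u -> (g (model f alpha0 u y) <= c0%:E)%E -> K y.
  move=> Ku /(rP _ _ Ku) yr; rewrite /K/= (@le_trans _ _ (rK - r0))// ?gerBl//.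
  rewrite /rK addrK -[enorm y]ger0_norm ?enorm_ge0// -sqrtr_sqr ler_wsqrtr//.
  apply: le_trans (enormB_sqr_le y u) _.
  have := K0_le _ Ku; have := enorm_ge0 u; have := enorm_ge0 (y - u); nra.
have eta1 := ltW eta_gt1.
have eta0 : 0 < eta by exact: lt_le_trans eta1.
have [C C1 CP] := step_size_bound f_convex f_C1 f_grad_lip alpha0_Gamma eta0
  (@enorm_ball_compact R n rK).
have range_G a : step_size_range alpha0 C a -> Gamma f a.
  exact: step_size_range_Gamma.
have stepP k : K0 (x k) -> step_size_range alpha0 C (alpha k) ->
    [/\ step_size_range alpha0 C (alpha k.+1),
        multiprox g f (alpha k.+1) (x k) (x k.+1),
        (gF (x k.+1) <= g (model f (alpha k.+1) (x k) (x k.+1)))%E &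
        argmin gF (x k) -> x k.+1 = x k].
  move=> Kxk akR; apply: (multiprox_stepP f_convex f_C1 g_mono eta1) (steps k) => //.
  move=> b y i bR ymin; apply: CP; [exact: range_G|exact: K0K|].
  apply: (modelK (x k)) => //.
  (* Since [b] dominates [alpha0], coercivity of the initial model alone confines the trial points
     for all step sizes. *)
  apply: le_trans (le_trans (multiprox_value_le ymin) Kxk).
  rewrite !modelE; apply: (model_value_le g_mono) => //; first exact: range_G.
    by have [] := bR.
  by rewrite lexx divr_ge0 ?sqr_ge0.
have inv k : K0 (x k) /\ step_size_range alpha0 C (alpha k).
  elim: k => [|k [Kxk akR]].
    split=> //; rewrite alpha_0; split=> i //; rewrite mxE ler_peMl//.
    by have [] := alpha0_Gamma i.
  have [ak1R xmin xle _] := stepP k Kxk akR; split=> //.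
  exact: le_trans xle (le_trans (multiprox_value_le xmin) Kxk).
have [s0 s0min] := gF_min.
pose vmin : R := fine (gF s0).
have gFs0 : gF s0 = vmin%:E.
  rewrite fineK// fin_numElt ltNye; have [-> _] := gF_proper.
  exact: le_lt_trans (s0min (x 0%N)) x0_dom.
have vmin_le u : (vmin%:E <= gF u)%E by rewrite -gFs0; exact: s0min.
have argminE u : gF u = vmin%:E -> argmin gF u by move=> uv y; rewrite uv.
have [[k xk_min]|no_min] := pselect (exists k, argmin gF (x k)).
  exists (x k) => //; apply: cvg_near_cst; exists k => // j /= /subnK <-.
  elim: (j - k)%N => // i IH; rewrite addSn.
  have [Kx aR] := inv (i + k)%N; have [_ _ _ ->//] := stepP _ Kx aR.
  by rewrite IH.
have [xb xb_int] := gF_int.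
(* [A] dominates every step size and [B] every [enorm (xb - x k) ^+ 2 / 2], so one shift of the
   interior point serves all iterations. *)
pose A := C *: alpha0.
have AR : step_size_range alpha0 C A.
  split=> i //; rewrite /A mxE ler_peMl//.
  by have [] := alpha0_Gamma i.
pose B := (2 * enorm xb ^+ 2 + 2 * r0 ^+ 2) / 2.
have [t /andP[t0 t1] w_dom] := interior_edom_shift ((B + 1) *: A) xb_int.
pose w := fine (g (vecfun f xb + t *: ((B + 1) *: A))).
have gw : (g (vecfun f xb + (t * (B + 1)) *: A)%R <= w%:E)%E.
  rewrite -scalerA fineK// fin_numElt ltNye; have [-> _] := g_proper.
  exact: w_dom.
pose M := t * w + (1 - t) * c0.
(* This dominates the multiplier bound [(M - G) / t ^+ 2] for every [G > vmin]; the absolute value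
   and the [1] ensure positivity. *)
pose Lam := `|(M - vmin) / t ^+ 2| + 1.
have t2 : 0 < t ^+ 2 by rewrite exprn_gt0.
have Lam0 : 0 < Lam by rewrite ltr_wpDl.
apply: (fejer_cvg (K := K0) (Lam := Lam) (vmin := vmin) (s0 := s0)) => //.
- by move=> k; have [] := inv k.
- move=> k; have [Kx aR] := inv k; have [_ xmin xle _] := stepP k Kx aR.
  exact: le_trans xle (multiprox_value_le xmin).
- move=> k s gFs; have [Kx aR] := inv k; have [ak1R xmin xle _] := stepP k Kx aR.
  set a := alpha k.+1 in ak1R xmin xle.
  pose G := fine (g (model f a (x k) (x k.+1))).
  have GE : g (model f a (x k) (x k.+1)) = G%:E.
    rewrite fineK// fin_numElt (lt_le_trans (ltNyr _) (le_trans (vmin_le _) xle))/=.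
    exact: le_lt_trans (le_trans (multiprox_value_le xmin) Kx) (ltry _).
  have vG : vmin < G.
    rewrite -lte_fin -GE; apply: lt_le_trans xle.
    rewrite lt_neqAle vmin_le andbT; apply/negP => /eqP vx.
    by apply: no_min; exists k.+1; apply: argminE.
  have xB : enorm (xb - x k) ^+ 2 / 2 <= B.
    rewrite ler_pM2r// (le_trans (enormD_sqr_le _ _))// enormN lerD2l ler_pM2l//.
    by rewrite ler_sqr ?nnegrE ?enorm_ge0// K0_le.
  have aA : vle a A by have [] := ak1R.
  have t01 : 0 <= t <= 1 by rewrite ltW.
  have slater := slater_value_le f_convex f_C1 g_convex g_mono (range_G _ ak1R)
    (range_G _ AR) aA t01 xB Kx gw.
  have [lam /andP[lam0 lam_le] lamP] :=
    multiprox_three_points f_convex f_C1 g_convex g_mono (range_G _ ak1R) xmin GE t2 (lexx _) slater.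
  have sv : (g (vecfun f s) <= vmin%:E)%E by rewrite -gFs.
  have := lamP _ _ sv.
  have -> : enorm (s - x k) = enorm (x k - s) by rewrite -enormN opprB.
  have -> : enorm (s - x k.+1) = enorm (x k.+1 - s) by rewrite -enormN opprB.
  set D := _ - _ => GD; apply: le_trans xle _; rewrite GE lee_fin.
  apply: (le_trans GD); rewrite lerD2l.
  have lamLam : lam <= Lam.
    apply: (le_trans lam_le); apply: (@le_trans _ _ ((M - vmin) / t ^+ 2)).
      by rewrite ler_pM2r ?invr_gt0// lerD2l lerN2 ltW.
    by rewrite (le_trans (ler_norm _))// lerDl.
  (* As [G > vmin], the inequality [GD] forces [D] to be positive, which is what allows [lam] to be
     replaced by the larger [Lam]. *)
  have D0 : 0 < D by rewrite ltNge; apply/negP => D0; nra.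
  nra.
Qed.
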